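(* Let $k\ge 1$ and $n\ge 1$ be integers. The number $\mathrm{scw}_{n,k}$ of smooth cyclic words of length $n$ over the alphabet $[k]$ is given by $$\mathrm{scw}_{n,k}=\sum_{j=1}^k\left[1+2\cos\Bigl(\frac{j\pi}{k+1}\Bigr)\right]^n.$$
   Context: $[k]=\{1,2,\ldots,k\}$, and $[k]^n$ is the set of words $\sigma=\sigma_1\cdots\sigma_n$ of length $n$ over $[k]$. A word $\sigma\in[k]^n$ is smooth if $|\sigma_{i+1}-\sigma_i|\le 1$ for all $1\le i\le n-1$, and smooth cyclic if it is smooth and in addition $|\sigma_n-\sigma_1|\le 1$ (so every word of length $1$ is smooth cyclic). *)

(* Defs.v *)
From mathcomp Require Import all_boot all_order all_algebra.

Set Implicit Arguments.
Unset Strict Implicit.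
Unset Printing Implicit Defensive.

(* A word of length n over {1, ..., k} is a w : n.-tuple 'I_k.  The letter a is
   encoded as the element a - 1 of 'I_k, and positions are numbered from 0; the
   conditions below only involve differences of letters, which the shift does
   not change. *)

Definition close_letters (k : nat) (a b : 'I_k) : bool :=
  (`|(b : nat)%:Z - (a : nat)%:Z| <= 1)%R.

Definition smooth (n k : nat) (w : n.-tuple 'I_k) : bool :=
  [forall i : 'I_n, forall j : 'I_n,
     (j == i.+1 :> nat) ==> close_letters (tnth w i) (tnth w j)].

(* i is the first position and j the last one. *)
Definition smooth_cyclic (n k : nat) (w : n.-tuple 'I_k) : bool :=
  smooth w &&
  [forall i : 'I_n, forall j : 'I_n,
     (i == 0 :> nat) && (j.+1 == n) ==> close_letters (tnth w i) (tnth w j)].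

Definition scw (n k : nat) : nat :=
  #|[set w : n.-tuple 'I_k | smooth_cyclic w]|.

(* Main.v *)
Require Import Defs.
From mathcomp Require Import all_boot all_order all_algebra.
From mathcomp Require Import reals trigo.
From mathcomp Require Import zify ring.

Local Open Scope ring_scope.
Import Order.TTheory GRing.Theory Num.Theory.

(** Smooth cyclic words of length [n] are the closed walks of length [n] in the
    graph on the letters whose edges join letters at distance at most 1 (with a
    loop at every letter): a word is the list of the vertices visited, the last
    letter being joined back to the first.  Hence their number is the trace of
    the [n]-th power of the adjacency matrix [A] of that graph
    ([adjacency_mx_exp], [scw_trace]).

    [A] is tridiagonal with all entries 1 on the three diagonals, so an
    eigenvector is a sequence with [f m + f m.+1 + f m.+2 = c * f m.+1] that
    vanishes at positions [0] and [k + 1].  By the addition formula for the sine,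
    [f m = sin (m x)] solves the recurrence with [c = 1 + 2 cos x], and both
    boundary values vanish when [x = j pi / (k + 1)] ([sine_mx_eigen]).  For
    [j = 1, ..., k] this gives [k] eigenvectors, whose eigenvalues are pairwise
    distinct because the cosine is injective on [[0, pi]].

    It remains to know that these eigenvectors form a basis
    ([eigenbasis_unitmx]).  As [A] is symmetric, eigenvectors for distinct
    eigenvalues are orthogonal, so no evaluation of trigonometric sums is
    needed.  The trace of [A ^+ n] is then the sum of the [n]-th powers of the
    eigenvalues. *)

(** * Closed walks and traces *)

Definition adjacency_mx (R : pzSemiRingType) {k : nat} (e : rel 'I_k) : 'M[R]_k :=
  \matrix_(i, j) (e i j)%:R.

(** Expanding [A * A ^+ n] splits the walks from [a] according to their first
    step.  The starting vertex [a] is not listed in [w], so that [w] has as many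
    entries as the walk has steps. *)
Lemma adjacency_mx_exp (R : pzSemiRingType) {k : nat} (e : rel 'I_k) (n : nat)
    (a b : 'I_k) :
  (adjacency_mx R e ^+ n) a b =
  #|[set w : n.-tuple 'I_k | path e a w && (last a w == b)]|%:R.
Proof.
elim: n a b => [|n IHn] a b.
  rewrite expr0 mxE; case: eqP => [->|ab].
    by rewrite (_ : [set _ | _] = setT) ?cardsT ?card_tuple //;
      apply/setP => w; rewrite tuple0 !inE /= eqxx.
  by rewrite (_ : [set _ | _] = set0) ?cards0 //;
    apply/setP => w; rewrite tuple0 !inE /=; apply/eqP.
rewrite exprS mxE.
under eq_bigr do rewrite mxE IHn -natrM mulnbl.
rewrite -natr_sum; congr _%:R.
pose h (w : n.+1.-tuple 'I_k) := thead w.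
(* The vertex [c] reached by the first step is the head of the walk. *)
rewrite -sum1_card (partition_big h xpredT) //=; apply: eq_bigr => c _.
rewrite sum1dep_card.
rewrite (_ : [set _ | _] = [set cons_tuple c w | w in
    [set w : n.-tuple 'I_k | e a c && (path e c w && (last c w == b))]]).
  rewrite card_imset; last by move=> u v [] /val_inj.
  case: (e a c) => //=.
  by apply/esym/eqP; rewrite cards_eq0; apply/eqP/setP => w; rewrite !inE.
apply/setP => w; rewrite !inE /h; case/tupleP: w => x w /=; rewrite theadE.
apply/idP/imsetP => [/andP[/andP[/andP[eax pw] lw] /eqP<-]|[v]].
  by exists w => //; rewrite inE eax pw.
by rewrite inE => /and3P[eac pv lv] [-> ->]; rewrite eac pv lv eqxx.
Qed.

(** The walks from [c] to [c] are the cyclic words with last letter [c]; a last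
    letter exists because the length is positive. *)
Lemma trace_adjacency_mx_exp (R : pzSemiRingType) {k : nat} (e : rel 'I_k) (n : nat) :
  \tr (adjacency_mx R e ^+ n.+1) =
  #|[set w : n.+1.-tuple 'I_k | cycle e w]|%:R.
Proof.
rewrite /mxtrace.
under eq_bigr do rewrite adjacency_mx_exp.
rewrite -natr_sum; congr _%:R.
pose h (w : n.+1.-tuple 'I_k) := last (thead w) w.
rewrite -[RHS]sum1_card (partition_big h xpredT) //=; apply: eq_bigr => c _.
rewrite sum1dep_card; apply: eq_card => w; rewrite !inE /h.
case/tupleP: w => x w /=; rewrite rcons_path.
by case: eqP => [->|]; rewrite ?andbF // !andbT andbC.
Qed.

(** * Smooth words as walks *)

Lemma smooth_sorted {n k : nat} (w : n.-tuple 'I_k) :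
  smooth w = sorted (@close_letters k) w.
Proof.
case: n w => [|n] w.
  by rewrite tuple0; apply/forallP => -[].
apply/forallP/(sortedP (thead w)) => [sm i|sm i].
  rewrite size_tuple => lt_in.
  have := forallP (sm (Ordinal (ltnW lt_in))) (Ordinal lt_in).
  by rewrite eqxx /= !(tnth_nth (thead w)).
apply/forallP => j; apply/implyP => /eqP ji.
by rewrite !(tnth_nth (thead w)) ji sm // size_tuple -ji.
Qed.

(** [cycle] also tests the pair (last letter, first letter), which is the cyclic
    condition up to the symmetry of [close_letters]; for words of length 1 that
    pair is a letter with itself. *)
Lemma smooth_cyclicE {n k : nat} (w : n.+1.-tuple 'I_k) :
  smooth_cyclic w = cycle (@close_letters k) w.
Proof.
have -> : cycle (@close_letters k) w =
    sorted (@close_letters k) w && close_letters (tnth w ord_max) (thead w).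
  case/tupleP: w => x w.
  rewrite theadE (tnth_nth x) /= rcons_path.
  by have := nth_last x (x :: w); rewrite /= size_tuple => ->.
have closeC (a b : 'I_k) : close_letters a b = close_letters b a.
  by rewrite /close_letters distrC.
rewrite /smooth_cyclic smooth_sorted; congr (_ && _).
rewrite closeC; apply/forallP/idP => [/(_ ord0)/forallP/(_ ord_max)|cl i].
  by rewrite /= eqxx.
apply/forallP => j; apply/implyP => /andP[/eqP i0 /eqP[jn]].
by have [-> ->] : i = ord0 /\ j = ord_max by split; apply: val_inj.
Qed.

Lemma scw_trace (R : pzSemiRingType) (n k : nat) :
  (scw n.+1 k)%:R = \tr (adjacency_mx R (@close_letters k) ^+ n.+1).
Proof.
rewrite trace_adjacency_mx_exp; congr _%:R.
by apply: eq_card => w; rewrite !inE smooth_cyclicE.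
Qed.

(** * Traces of powers from an eigenbasis *)

(** The columns of [S] are nonzero eigenvectors of the symmetric matrix [A] for
    pairwise distinct eigenvalues, hence pairwise orthogonal: the Gram matrix
    [S^T *m S] commutes with the diagonal matrix of eigenvalues, so it is
    diagonal, and its diagonal entries are nonzero sums of squares. *)
Lemma eigenbasis_unitmx {F : realFieldType} {k : nat} {A S : 'M[F]_k} {d : 'rV[F]_k} :
    A^T = A -> A *m S = S *m diag_mx d -> injective (d 0) ->
    (forall j, exists i, S i j != 0) ->
  S \in unitmx.
Proof.
move=> symA AS d_inj S_neq0.
pose G := S^T *m S.
have G_comm : diag_mx d *m G = G *m diag_mx d.
  have AS_tr : diag_mx d *m S^T = S^T *m A.
    by rewrite -{1}(tr_diag_mx d) -trmx_mul -AS trmx_mul symA.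
  by rewrite /G mulmxA AS_tr -!mulmxA AS.
have G_diag i j : i != j -> G i j = 0.
  move=> ij; have := congr1 (fun M : 'M_k => M i j) G_comm.
  rewrite mul_diag_mx mul_mx_diag !mxE -/G => /eqP.
  rewrite mulrC -subr_eq0 -mulrBr mulf_eq0 subr_eq0 (inj_eq d_inj) (negPf ij).
  by rewrite orbF => /eqP.
have G_gt0 j : 0 < G j j.
  have [i Sij] := S_neq0 j.
  rewrite mxE (bigD1 i) //= mxE ltr_pwDl //.
    by rewrite -expr2 exprn_even_gt0.
  by apply: sumr_ge0 => l _; rewrite mxE -expr2 sqr_ge0.
have GE : G = diag_mx (\row_j G j j).
  apply/matrixP => i j; rewrite [RHS]mxE [X in X *+ _]mxE.
  by have [->|/G_diag->] := eqVneq i j.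
have : G \in unitmx.
  rewrite GE unitmxE det_diag unitfE; apply/prodf_neq0 => j _.
  by rewrite mxE gt_eqF.
by rewrite unitmx_mul => /andP[].
Qed.

Lemma trace_exp_diagonalized {R : comUnitRingType} {k : nat} {A S : 'M[R]_k}
    {d : 'rV[R]_k} (n : nat) :
    S \in unitmx -> A *m S = S *m diag_mx d ->
  \tr (A ^+ n) = \sum_j d 0 j ^+ n.
Proof.
move=> Su AS.
have AnS : A ^+ n *m S = S *m diag_mx (\row_j d 0 j ^+ n).
  elim: n => [|n IHn].
    rewrite expr0 mul1mx -[LHS]mulmx1; congr (_ *m _).
    by apply/matrixP => i j; rewrite !mxE expr0.
  rewrite exprS -mulmxA IHn mulmxA AS -mulmxA mulmx_diag.
  by congr (_ *m diag_mx _); apply/rowP => j; rewrite !mxE exprS.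
rewrite -[A ^+ n](mulmxK Su) AnS mxtrace_mulC mulKmx // mxtrace_diag.
by apply: eq_bigr => j _; rewrite mxE.
Qed.

(** * The spectrum of the smooth-word graph *)

(** The action of the adjacency matrix on the vector [f 1, ..., f k]: the shift
    by one puts the letters at positions [1, ..., k], and the values [f 0 = 0] and
    [f k.+1 = 0] stand for the missing neighbours of the first and last letters,
    which makes the formula uniform in [i]. *)
Lemma close_letters_row_sum {R : pzRingType} {k : nat} (f : nat -> R) (i : 'I_k) :
    f 0%N = 0 -> f k.+1 = 0 ->
  \sum_j (close_letters i j)%:R * f j.+1 = f i + f i.+1 + f i.+2.
Proof.
move=> f0 fk.
(* A row of the matrix is a sum of three indicators, each of which selects one
   value of [f], or a zero boundary value when it selects no letter. *)
have pick m : (m <= k.+1)%N -> \sum_(j < k) (j.+1 == m)%:R * f j.+1 = f m.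
  rewrite leq_eqVlt => /predU1P[->|].
    rewrite fk big1 // => j _.
    by rewrite eqSS ltn_eqF // mul0r.
  case: m => [_|m ltmk].
    by rewrite f0 big1 // => j _; rewrite mul0r.
  rewrite (bigD1 (Ordinal (ltmk : m < k)%N)) //= eqxx mul1r big1 ?addr0 // => j.
  by rewrite -val_eqE /= eqSS => /negPf->; rewrite mul0r.
have ltik := ltn_ord i.
rewrite -(pick i) -?(pick i.+1) -?(pick i.+2) ?ltnS //; try lia.
rewrite -!big_split /=; apply: eq_bigr => j _; rewrite -!mulrDl -!natrD.
congr (_%:R * _); rewrite /close_letters; lia.
Qed.

Section Spectrum.
Variables (R : realType) (k : nat).

Definition angle (j : nat) : R := j%:R * pi / k.+1%:R.

(** The addition formula: [sin (y - x) + sin (y + x) = 2 cos x sin y]. *)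
Lemma sin_recurrence (x : R) (m : nat) :
  sin (m%:R * x) + sin (m.+1%:R * x) + sin (m.+2%:R * x) =
  (1 + 2 * cos x) * sin (m.+1%:R * x).
Proof.
have -> : m%:R * x = m.+1%:R * x - x by rewrite -natr1; ring.
have -> : m.+2%:R * x = m.+1%:R * x + x by rewrite -[m.+2%:R]natr1; ring.
by rewrite sinB sinD; ring.
Qed.

Lemma angle_bounds (j : nat) : (0 < j < k.+1)%N -> 0 < angle j < pi.
Proof.
move=> /andP[j0 jk]; have pi0 := pi_gt0 R.
rewrite /angle divr_gt0 ?mulr_gt0 ?ltr0n //=.
by rewrite ltr_pdivrMr ?ltr0n // mulrC ltr_pM2l // ltr_nat.
Qed.

Lemma sin_nat_pi (j : nat) : sin (j%:R * pi : R) = 0.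
Proof.
elim: j => [|j IHj]; first by rewrite mul0r sin0.
by rewrite -natr1 mulrDl mul1r sinDpi IHj oppr0.
Qed.

Definition sine_mx : 'M[R]_k := \matrix_(i, j) sin (i.+1%:R * angle j.+1).

Definition eigenvalues : 'rV[R]_k := \row_j (1 + 2 * cos (angle j.+1)).

Lemma sine_mx_eigen :
  adjacency_mx R (@close_letters k) *m sine_mx = sine_mx *m diag_mx eigenvalues.
Proof.
apply/matrixP => i j; rewrite mul_mx_diag !mxE.
pose f m := sin (m%:R * angle j.+1).
transitivity (f i + f i.+1 + f i.+2); last by rewrite sin_recurrence mulrC.
rewrite -close_letters_row_sum.
- by apply: eq_bigr => l _; rewrite !mxE.
- by rewrite /f mul0r sin0.
- by rewrite /f /angle mulrC divfK ?pnatr_eq0 // sin_nat_pi.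
Qed.

Lemma eigenvalues_inj : injective (eigenvalues 0).
Proof.
move=> i j; rewrite !mxE => /addrI /(mulfI _) => /(_ (lt0r_neq0 (ltr0n _ 2))) cosE.
have in_pi (l : 'I_k) : angle l.+1 \in `[0, pi].
  have /andP[l0 lp] : 0 < angle l.+1 < pi by apply: angle_bounds; rewrite /= ltnS.
  by rewrite in_itv /= !ltW.
have /(divIf _) : angle i.+1 = angle j.+1 by apply: cos_inj.
rewrite pnatr_eq0 => /(_ isT) /(mulIf (lt0r_neq0 (pi_gt0 R))) /eqP.
by rewrite eqr_nat eqSS => /eqP/val_inj.
Qed.

Lemma sine_mx_unit : sine_mx \in unitmx.
Proof.
apply: (eigenbasis_unitmx _ sine_mx_eigen eigenvalues_inj).
  by apply/matrixP => i j; rewrite !mxE /close_letters distrC.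
move=> j; have k_gt0 : (0 < k)%N by case: k j => // -[].
(* All multiples involved in the first row are angles strictly between 0 and pi,
   so this row has no zero entry. *)
exists (Ordinal k_gt0); rewrite mxE mul1r gt_eqF // sin_gt0_pi //.
by apply: angle_bounds; rewrite /= ltnS.
Qed.

End Spectrum.

Theorem theorem3p3 (R : realType) (k n : nat) (hk : (1 <= k)%N) (hn : (1 <= n)%N) :
  (scw n k)%:R =
  \sum_(1 <= j < k.+1) (1 + 2 * cos (j%:R * pi / k.+1%:R)) ^+ n :> R.
Proof.
case: n hn => // n _.
rewrite scw_trace (trace_exp_diagonalized _ (sine_mx_unit R k) (sine_mx_eigen R k)).
rewrite big_add1 /= big_mkord.
by apply: eq_bigr => j _; rewrite mxE.
Qed.
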